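(* Let $A,B\in\mathbb M_n(\mathbb C)$ be positive semidefinite and let $Z\in\mathbb M_n(\mathbb C)$ be arbitrary. Then the limit $$\lim_{p\to\infty}\bigl(A^pZ^*B^pZA^p\bigr)^{1/p}$$ exists in norm.
   Context: $\mathbb M_n(\mathbb C)$ is the algebra of complex $n\times n$ matrices. Here $p$ ranges over positive real numbers; for positive semidefinite $T$ and $s>0$, $T^s$ is the positive semidefinite power defined by functional calculus. Convergence is in the operator norm. *)

(* Defs.v *)
From mathcomp Require Import all_boot all_order all_algebra.
From mathcomp Require Import spectral.
From mathcomp Require Import complex.
From mathcomp Require Import all_classical all_reals all_analysis.

Set Implicit Arguments.
Unset Strict Implicit.
Unset Printing Implicit Defensive.

Import Order.TTheory GRing.Theory Num.Theory.
Import numFieldNormedType.Exports.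

Local Open Scope classical_set_scope.
Local Open Scope ring_scope.
Local Open Scope sesquilinear_scope.
Local Open Scope complex_scope.

(* [0 <= z] on [R[i]] says that [z] is real and nonnegative. *)
Definition psd (R : realType) (n : nat) (A : 'M[R[i]]_n) : Prop :=
  A^t* = A /\ forall x : 'cV[R[i]]_n, 0 <= (x^t* *m A *m x) 0 0.

(* For a Hermitian [T] with diagonalization [T = U^t* *m diag_mx d *m U],
   [d] real and [U] unitary, this is [f(T)].  It does not depend on the
   diagonalization, so we take the one chosen by [spectralmx].  The value is
   meaningless when [T] is not Hermitian. *)
Definition funcalc (R : realType) (n : nat) (f : R -> R) (T : 'M[R[i]]_n) :
    'M[R[i]]_n :=
  (spectralmx T)^t*
    *m diag_mx (\row_j (f (complex.Re (spectral_diag T 0 j)))%:C)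
    *m spectralmx T.

(* Meant for [psd T] and [0 < s]; note that [0 `^ s = 0] for [s != 0]. *)
Definition psdpow (R : realType) (n : nat) (T : 'M[R[i]]_n) (s : R) :
    'M[R[i]]_n :=
  funcalc (fun x => x `^ s) T.

Definition l2norm (R : realType) (n : nat) (x : 'cV[R[i]]_n) : R :=
  Num.sqrt (\sum_i ComplexField.Normc.normc (x i 0) ^+ 2).

Definition opnorm (R : realType) (n : nat) (T : 'M[R[i]]_n) : R :=
  sup [set l2norm (T *m x) | x in [set x : 'cV[R[i]]_n | l2norm x <= 1]].

(* Main.v *)
(** Write [M p] for the matrix whose [p]-th root is taken.  Its entries are
    exponential sums [sum_k c_k exp (l_k p)], and so are those of its adjugates
    and determinants.  For [r > 0], Cramer's rule expresses the entries of
    [M p (M p + r^p)^-1] as quotients of exponential sums; these quotients are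
    bounded, hence convergent, since a nonzero exponential sum is equivalent to
    a single term [c exp (l p)].

    On the other hand [x^p / (x^p + r^p)] tends to the indicator function of
    [x > r], so that [x] is approximated, uniformly on [[0, C]] for large [p],
    by a Riemann sum [sum_j d x^p / (x^p + r_j^p)] with [r_j = (j + 1) d].
    Applied to [x = lam^(1/p)] for the eigenvalues [lam] of [M p], this places
    [(M p)^(1/p)] within any prescribed distance of a convergent family, so it
    is Cauchy.  Convergence is proved entrywise, on the real numbers
    [Re (c z)] for [c = 1] and [c = -i]. *)

Require Import Defs.
From mathcomp Require Import all_boot all_order all_algebra.
From mathcomp Require Import spectral.
From mathcomp Require Import ring lra.
From mathcomp Require Import complex.
From mathcomp Require Import all_classical all_reals all_analysis.

Set Implicit Arguments.
Unset Strict Implicit.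
Unset Printing Implicit Defensive.

Import Order.TTheory GRing.Theory Num.Theory.
Import numFieldNormedType.Exports.

Local Open Scope classical_set_scope.
Local Open Scope ring_scope.
Local Open Scope sesquilinear_scope.
Local Open Scope complex_scope.

(** * Real exponential sums: leading term, bounded quotients, growth and closure properties *)

Section ExponentialSums.
Variable R : realType.
Implicit Types (s : seq (R * R)) (f g h : R -> R) (p : R).

Definition expsum s p : R := \sum_(x <- s) x.1 * expR (x.2 * p).

Lemma expR_cvgy0 (l : R) : 0 < l -> expR (- (l * p)) @[p --> +oo] --> (0 : R).
Proof.
move=> l0; have H : l * p @[p --> +oo] --> +oo by apply: gt0_cvgMry.
exact: (cvg_comp _ _ H (@cvgr_expR R)).
Qed.

Lemma expsum_below s (l : R) : (forall x, x \in s -> x.2 < l) ->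
  expsum s p * expR (- (l * p)) @[p --> +oo] --> (0 : R).
Proof.
elim: s => [|x s IH] hs.
  rewrite (_ : (fun _ => _) = cst 0); first exact: cvg_cst.
  by apply/funext => p; rewrite /expsum big_nil mul0r.
rewrite (_ : (fun _ => _) = (fun p => x.1 * expR (- ((l - x.2) * p)) +
    expsum s p * expR (- (l * p)))); last first.
  apply/funext => p; rewrite /expsum big_cons mulrDl -mulrA -expRD.
  by congr (_ * expR _ + _); ring.
rewrite [X in _ --> X](_ : 0 = x.1 * 0 + 0); last by rewrite mulr0 addr0.
apply: cvgD.
  by apply: cvgMr; apply: expR_cvgy0; rewrite subr_gt0 hs ?mem_head.
by apply: IH => y ys; rewrite hs// in_cons ys orbT.
Qed.

(** Group the terms of largest exponent [l]. If their coefficients add up to a nonzero [c], the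
    other terms are negligible against [expR (l * p)]. If they cancel, the group is dropped and
    strong induction on the number of terms applies. *)
Lemma expsum_lead s :
  expsum s =1 cst 0 \/
  exists l c : R, c != 0 /\ expsum s p * expR (- (l * p)) @[p --> +oo] --> c.
Proof.
have [n] := ubnP (size s); elim: n s => // n IH [|x0 s0] hs.
  by left=> p; rewrite /expsum big_nil.
set s := x0 :: s0 in hs *.
have [x xs xmax] : exists2 x, x \in s & forall y, y \in s -> y.2 <= x.2.
  rewrite /s; elim: s0 x0 {s hs} => [|y s0 IHs] x0.
    by exists x0; rewrite ?mem_head// => y; rewrite inE => /eqP ->.
  have [z zs zmax] := IHs y.
  have [le|lt] := leP x0.2 z.2.
    exists z; first by rewrite in_cons zs orbT.
    by move=> w; rewrite in_cons => /orP[/eqP->//|/zmax].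
  exists x0; first exact: mem_head.
  move=> w; rewrite in_cons => /orP[/eqP->//|/zmax /le_trans]; apply.
  exact: ltW.
pose l := x.2; pose c := \sum_(y <- s | y.2 == l) y.1.
pose s' := [seq y <- s | y.2 != l].
have split p : expsum s p = c * expR (l * p) + expsum s' p.
  rewrite /expsum (bigID (fun y => y.2 == l))/= big_filter /c mulr_suml.
  by congr (_ + _); apply: eq_bigr => y /eqP ->.
have s'lt y : y \in s' -> y.2 < l.
  by rewrite mem_filter => /andP[ne /xmax]; rewrite le_eqVlt (negbTE ne).
have [c0|cN0] := eqVneq c 0.
  have hs' : (size s' < n)%N.
    rewrite -ltnS; apply: leq_trans hs; rewrite ltnS size_filter.
    rewrite -(count_predC (fun y => y.2 == l)) -addn1 addnC leq_add2r.
    by rewrite -has_count; apply/hasP; exists x.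
  have -> : expsum s = expsum s'.
    by apply/funext => p; rewrite split c0 mul0r add0r.
  exact: IH.
right; exists l, c; split=> //.
rewrite (_ : (fun _ => _) = (fun p => c + expsum s' p * expR (- (l * p)))).
  rewrite -[X in _ --> X]addr0; apply: cvgD; first exact: cvg_cst.
  exact: expsum_below.
by apply/funext => p; rewrite split mulrDl -mulrA expRxMexpNx_1 mulr1.
Qed.

(** By [expsum_lead] the quotient behaves like [c / d * expR (k * p)], where [k] is the difference
    of the leading exponents; boundedness rules out [k > 0]. *)
Lemma expsum_ratio_cvg s t h (M : R) :
  (\forall p \near +oo, expsum t p != 0) ->
  (\forall p \near +oo, `|h p| <= M) ->
  (\forall p \near +oo, h p * expsum t p = expsum s p) ->
  cvg (h p @[p --> +oo]).
Proof.
move=> tN0 hM hts; set f := expsum s; set g := expsum t.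
have [f0|[l [c [cN0 fc]]]] := expsum_lead s.
  apply: (@cvgP _ _ (0 : R)).
  apply: cvg_near_cst; near=> p.
  have /eqP : h p * g p = 0 by rewrite -[RHS](f0 p); near: p.
  rewrite mulf_eq0 => /orP[/eqP//|/eqP gp].
  have : expsum t p != 0 by near: p.
  by rewrite -/g gp eqxx.
have [g0|[m [d [dN0 gd]]]] := expsum_lead t.
  have /filter_ex [p] := tN0.
  by rewrite g0 eqxx.
pose k := l - m.
have hk : h p * expR (- (k * p)) @[p --> +oo] --> c / d.
  apply: cvg_trans (cvgM fc (cvgV dN0 gd)).
  apply: near_eq_cvg; near=> p.
  rewrite /= -/f -/g.
  have gp0 : g p != 0 by near: p.
  have <- : h p * g p = f p by near: p.
  rewrite invfM -expRN opprK.
  rewrite mulrACA mulrA -(mulrA (h p)) mulfV // mulr1.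
  rewrite -mulrA -expRD; congr (_ * expR _); rewrite /k; ring.
have [k0|k0|k0] := ltgtP k 0.
- apply: (@cvgP _ _ (c / d * 0 : R)).
  have nk0 : 0 < - k by rewrite oppr_gt0.
  apply: cvg_trans (cvgM hk (expR_cvgy0 nk0)).
  apply: near_eq_cvg; near=> p; rewrite /= -mulrA -expRD.
  by rewrite mulNr opprK addNr expR0 mulr1.
(* For [k > 0] a bounded [h] would force [c / d = 0]. The bound [M] is replaced by [|M| + 1] to
   divide by a positive number. *)
- have : h p * expR (- (k * p)) @[p --> +oo] --> (0 : R).
    apply/cvgr0Pnorm_le => e e0.
    have M0 : 0 < `|M| + 1 by rewrite ltr_wpDl.
    have /cvgr0Pnorm_le/(_ (e / (`|M| + 1)) (divr_gt0 e0 M0)) H := expR_cvgy0 k0.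
    near=> p; rewrite normrM.
    rewrite -[e](divfK (lt0r_neq0 M0)) mulrC.
    apply: ler_pM => //; first by near: p.
    apply: (@le_trans _ _ M); first by near: p.
    by rewrite (le_trans (ler_norm _))// lerDl.
  move=> h0; have cd0 : c / d = 0 by exact: cvg_unique hk h0.
  by move/eqP: cd0; rewrite mulf_eq0 invr_eq0 (negbTE cN0) (negbTE dN0).
- apply: (@cvgP _ _ (c / d : R)); move: hk.
  by rewrite k0; under eq_fun do rewrite mul0r oppr0 expR0 mulr1.
Unshelve. all: by end_near. Qed.

Lemma expsum_growth s : exists C : R, 0 < C /\
  forall p, 1 <= p -> forall x, 0 <= x -> x <= expsum s p -> x `^ p^-1 <= C.
Proof.
pose K := \sum_(y <- s) `|y.1| + 1; pose L := \sum_(y <- s) `|y.2|.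
have K1 : 1 <= K by rewrite lerDr sumr_ge0.
have Ks p : 1 <= p -> expsum s p <= K * expR (L * p).
  move=> p1; have p0 : 0 <= p := le_trans ler01 p1.
  apply: (@le_trans _ _ ((\sum_(y <- s) `|y.1|) * expR (L * p))); last first.
    by rewrite ler_wpM2r ?expR_ge0// lerDl.
  rewrite /expsum mulr_suml big_seq [leRHS]big_seq ler_sum// => y ys.
  apply: (@le_trans _ _ (`|y.1| * expR (y.2 * p))).
    by rewrite ler_wpM2r ?expR_ge0 ?ler_norm.
  rewrite ler_wpM2l ?normr_ge0// ler_expR ler_wpM2r//.
  rewrite (le_trans (ler_norm _))// /L (big_rem y)//= lerDl sumr_ge0//.
exists (K * expR L); split.
  by rewrite mulr_gt0 ?expR_gt0// (lt_le_trans ltr01).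
move=> p p1 x x0 xs; have p0 : 0 < p := lt_le_trans ltr01 p1.
have K0 : 0 <= K := le_trans ler01 K1.
apply: (@le_trans _ _ ((K * expR (L * p)) `^ p^-1)).
  by rewrite ge0_ler_powR ?invr_ge0 ?(ltW p0)// ?nnegrE ?mulr_ge0 ?expR_ge0//;
    exact: le_trans xs (Ks p p1).
rewrite powRM ?expR_ge0// -expRM.
rewrite mulrAC -mulrA mulVf ?gt_eqF// mulr1 ler_wpM2r ?expR_ge0//.
by rewrite ler1_powR// invf_le1.
Qed.

(** Restricting to [p > 0] lets [0]^ p[count as the zero sum, although]0 [^ 0 = 1]. *)
Definition is_expsum f := exists s, forall p, 0 < p -> f p = expsum s p.

Lemma is_expsum_ext f g : (forall p, 0 < p -> f p = g p) ->
  is_expsum g -> is_expsum f.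
Proof. by move=> fg [s gs]; exists s => p p0; rewrite fg// gs. Qed.

Lemma is_expsum_exp (l : R) : is_expsum (fun p => expR (l * p)).
Proof. by exists [:: (1, l)] => p _; rewrite /expsum big_seq1 mul1r. Qed.

Lemma is_expsum_cst (c : R) : is_expsum (cst c).
Proof.
by exists [:: (c, 0)] => p _; rewrite /expsum big_seq1 mul0r expR0 mulr1.
Qed.

Lemma is_expsumD f g : is_expsum f -> is_expsum g -> is_expsum (f \+ g).
Proof.
move=> [s fs] [t gt]; exists (s ++ t) => p p0.
by rewrite /expsum big_cat /= fs// gt.
Qed.

Lemma is_expsumM f g : is_expsum f -> is_expsum g -> is_expsum (f \* g).
Proof.
move=> [s fs] [t gt].
exists [seq (x.1 * y.1, x.2 + y.2) | x <- s, y <- t] => p p0.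
rewrite /= fs// gt// /expsum big_allpairs_dep mulr_suml; apply: eq_bigr => x _.
rewrite mulr_sumr; apply: eq_bigr => y _ /=.
by rewrite mulrDl expRD mulrACA.
Qed.

Lemma is_expsum_powR (a : R) : is_expsum (fun p => a `^ p).
Proof.
have [->|aN0] := eqVneq a 0.
  apply: is_expsum_ext (is_expsum_cst 0) => p p0.
  by rewrite powR0// gt_eqF.
apply: is_expsum_ext (is_expsum_exp (ln a)) => p p0.
by rewrite /powR (negbTE aN0) mulrC.
Qed.

End ExponentialSums.

(** * Uniform approximation of the identity on [[0, C]] by sums of sigmoids *)

Section StepApproximation.
Variable R : realType.
Implicit Types (x y p C : R) (N : nat).

Lemma sum_indic_le y N : 0 <= y -> \sum_(j < N) ((j%:R < y)%R%:R : R) <= y + 1.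
Proof.
(* The bound by [N] is carried along: when [N < y] the new term is 1, and [N + 1 <= y + 1] closes
   the step. *)
move=> y0; suff [] : \sum_(j < N) ((j%:R < y)%R%:R : R) <= N%:R /\
  \sum_(j < N) ((j%:R < y)%R%:R : R) <= y + 1 by [].
elim: N => [|N [IH1 IH2]]; first by rewrite big_ord0; split; lra.
rewrite big_ord_recr /= -natr1; case: ltP => h /=; split; lra.
Qed.

Lemma sum_indic_ge y N : y <= N%:R ->
  y - 2 <= \sum_(j < N) ((j.+2%:R <= y)%R%:R : R).
Proof.
(* The minimum gives a bound valid for every [N], on which induction is possible. *)
move=> yN; suff : Num.min N%:R (y - 2) <= \sum_(j < N) ((j.+2%:R <= y)%R%:R : R).
  by apply: le_trans; rewrite le_min lexx andbT; lra.
elim: {yN} N => [|N IH]; first by rewrite big_ord0 ge_min lexx.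
move: IH; rewrite big_ord_recr /= !ge_min; set S := \sum_(_ < _) _.
have e1 : N.+1%:R = N%:R + 1 :> R by rewrite natr1.
have e2 : N.+2%:R = N%:R + 2 :> R by rewrite -addn2 natrD.
rewrite e1 e2; have [h /orP[h'|h']|h /orP[h'|h']] := leP (N%:R + 2) y;
  rewrite /= ?mulr1n ?mulr0n; apply/orP.
- by left; lra.
- by left; lra.
- by right; lra.
- by right; lra.
Qed.

(* In the variable [x] with [lam = x `^ p], a smoothed indicator function of
   [x > r]. *)
Definition sigmoid (r p lam : R) : R := lam / (lam + r `^ p).

Lemma sigmoid_ge0 r p lam : 0 <= lam -> 0 <= sigmoid r p lam.
Proof. by move=> l0; rewrite divr_ge0 ?addr_ge0 ?powR_ge0. Qed.

Lemma sigmoid_le1 r p lam : 0 < r -> 0 <= lam -> sigmoid r p lam <= 1.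
Proof.
move=> r0 l0; rewrite ler_pdivrMr ?mul1r ?lerDl ?powR_ge0//.
by rewrite ltr_wpDl ?powR_gt0.
Qed.

(** The sigmoid is at most [(x / r)]^ p[, its denominator being at least]r [^ p]. *)
Lemma sigmoid_above r p x q : 0 < r -> 0 < p -> 0 <= x -> 0 <= q ->
  x <= q * r -> sigmoid r p (x `^ p) <= q `^ p.
Proof.
move=> r0 p0 x0 q0 xqr.
rewrite ler_pdivrMr; last by rewrite ltr_wpDl ?powR_gt0 ?powR_ge0.
apply: (@le_trans _ _ (q `^ p * r `^ p)).
  by rewrite -powRM ?(ltW r0)// ge0_ler_powR ?(ltW p0)// nnegrE mulr_ge0// ltW.
by rewrite ler_wpM2l ?powR_ge0// lerDr powR_ge0.
Qed.

Lemma sigmoid_below r p x q : 0 < r -> 0 < p -> 0 <= x -> 0 <= q ->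
  r <= q * x -> 1 - q `^ p <= sigmoid r p (x `^ p).
Proof.
move=> r0 p0 x0 q0 rqx.
have d0 : 0 < x `^ p + r `^ p by rewrite ltr_wpDl ?powR_gt0 ?powR_ge0.
rewrite ler_pdivlMr//.
have : r `^ p <= q `^ p * x `^ p.
  by rewrite -powRM// ge0_ler_powR ?(ltW p0)// nnegrE ?mulr_ge0// ltW.
have := mulr_ge0 (powR_ge0 q p) (powR_ge0 r p); lra.
Qed.

Lemma powR_cvgy0 (q : R) : 0 <= q < 1 -> q `^ p @[p --> +oo] --> (0 : R).
Proof.
move=> /andP[]; rewrite le_eqVlt => /orP[/eqP<- _|q0 q1].
  apply: cvg_near_cst; near=> p; rewrite powR0//.
  by rewrite gt_eqF//; near: p; exact: nbhs_pinfty_gt.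
have l0 : 0 < - ln q by rewrite oppr_gt0 ln_lt0 ?q0.
apply: cvg_trans (expR_cvgy0 l0); apply: near_eq_cvg; near=> p.
by rewrite /powR gt_eqF//; congr expR; ring.
Unshelve. all: by end_near. Qed.

Lemma sigmoid_approx C eps : 0 < C -> 0 < eps ->
  exists N (d : R), 0 < d /\ \forall p \near +oo, forall x, 0 <= x <= C ->
    `|x - \sum_(j < N) d * sigmoid (j.+1%:R * d) p (x `^ p)| <= eps.
Proof.
move=> C0 e0.
(* With mesh [d = C / N] this makes [4 * d <= eps]; the error found below is at most [3 * d]. *)
have [N0 N0P] : exists N0 : nat, 4 * C / eps < N0%:R.
  by exists (Num.trunc (4 * C / eps)).+1; apply: truncnS_gt.
have c0 : 0 < 4 * C / eps by rewrite divr_gt0// mulr_gt0.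
pose N := N0; have Npos : (0 : R) < N%:R by apply: lt_trans N0P.
have N1 : (1 : R) <= N%:R by rewrite ler1n -(ltr0n R).
pose d : R := C / N%:R; have d0 : 0 < d by rewrite divr_gt0.
have dN : N%:R * d = C by rewrite mulrC divfK// gt_eqF.
have de : 4 * d <= eps.
  by rewrite /d mulrA ler_pdivrMr// [leRHS]mulrC -ler_pdivrMr// ltW.
exists N, d; split=> //.
(* Two points of [[0, C]] at distance at least [d = C / N] have ratio at most [q]. For large [p]
   each sigmoid at such a distance then errs by at most [1 / N], so all [N] of them together by at
   most 1. *)
pose q : R := 1 - N%:R^-1.
have q01 : 0 <= q < 1.
  by rewrite /q subr_ge0 invf_le1// N1 gtrBl invr_gt0.
have /andP[q0 q1] := q01.
have qd y : y <= C -> y - d <= q * y.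
  move=> yC; rewrite /q mulrBl mul1r lerB// /d mulrC.
  by rewrite ler_wpM2r ?invr_ge0 ?(ltW Npos).
have /cvgr0Pnorm_le/(_ N%:R^-1) qP := powR_cvgy0 q01.
near=> p => x /andP[x0 xC].
have p0 : 0 < p by near: p; exact: nbhs_pinfty_gt.
have qp : q `^ p <= N%:R^-1.
  rewrite -[leLHS]ger0_norm ?powR_ge0//; near: p; apply: qP.
  by rewrite invr_gt0.
pose y := x / d; have yd : y * d = x by rewrite divfK// gt_eqF.
have y0 : 0 <= y by rewrite divr_ge0// ltW.
have yN : y <= N%:R by rewrite ler_pdivrMr// dN.
have rpos (j : nat) : 0 < j.+1%:R * d by rewrite mulr_gt0 ?ltr0n.
(* The threshold is [(j + 1) d]: if [y <= j], then [x] lies at least [d] below it. Otherwise the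
   trivial bound 1 is used. *)
have upper (j : 'I_N) :
    sigmoid (j.+1%:R * d) p (x `^ p) <= (j%:R < y)%R%:R + N%:R^-1.
  have [jy|yj] := ltP (j%:R : R) y.
    apply: (le_trans (sigmoid_le1 _ (rpos j) (powR_ge0 _ _))).
    by rewrite lerDl invr_ge0 ltW.
  rewrite add0r; apply: le_trans qp; apply: sigmoid_above => //.
  apply: le_trans (qd _ _); last by rewrite -dN ler_wpM2r ?(ltW d0)// ler_nat.
  rewrite -yd -natr1 mulrDl mul1r addrK.
  by rewrite ler_wpM2r ?(ltW d0).
(* If [j + 2 <= y], then [x] lies at least [d] above the threshold. Otherwise the trivial bound 0 is
   used. *)
have lower (j : 'I_N) :
    (j.+2%:R <= y)%R%:R - N%:R^-1 <= sigmoid (j.+1%:R * d) p (x `^ p).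
  have [jy|yj] := leP (j.+2%:R : R) y.
    apply: (@le_trans _ _ (1 - q `^ p)); first by rewrite lerB.
    apply: sigmoid_below => //; apply: le_trans (qd _ xC).
    rewrite -yd lerBrDr -{2}(mul1r d) -mulrDl natr1.
    by rewrite ler_wpM2r ?(ltW d0).
  rewrite sub0r; apply: le_trans (sigmoid_ge0 _ _ (powR_ge0 _ _)).
  by rewrite oppr_le0 invr_ge0 ltW.
have sN : \sum_(j < N) (N%:R^-1 : R) = 1.
  by rewrite sumr_const card_ord -[LHS]mulr_natr mulVf// gt_eqF.
have U : \sum_(j < N) sigmoid (j.+1%:R * d) p (x `^ p) <= y + 2.
  apply: (@le_trans _ _ (\sum_(j < N) ((j%:R < y)%R%:R + N%:R^-1))).
    exact: ler_sum.
  by rewrite big_split /= sN; have := sum_indic_le N y0; lra.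
have L : y - 3 <= \sum_(j < N) sigmoid (j.+1%:R * d) p (x `^ p).
  apply: (@le_trans _ _ (\sum_(j < N) ((j.+2%:R <= y)%R%:R - N%:R^-1))); last first.
    exact: ler_sum.
  by rewrite sumrB sN; have := sum_indic_ge yN; lra.
rewrite -mulr_sumr; apply: le_trans de.
move: U L; set S := \sum_(_ < _) _ => U L.
rewrite -yd mulrC -mulrBr normrM (ger0_norm (ltW d0)) mulrC ler_wpM2r ?(ltW d0)//.
by rewrite ler_norml; lra.
Unshelve. all: by end_near. Qed.

End StepApproximation.

(** * Functional calculus of Hermitian matrices *)

Section FunctionalCalculus.
Variables (R : realType) (n : nat).
Implicit Types (T : 'M[R[i]]_n) (f g : R -> R) (c z : R[i]).

Definition eigval T j : R := complex.Re (spectral_diag T 0 j).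

Lemma Re_mulrC (r : R) z : complex.Re (r%:C * z) = r * complex.Re z.
Proof. by case: z => a b /=; rewrite mul0r subr0. Qed.

Lemma normc_ge0 z : 0 <= ComplexField.Normc.normc z.
Proof. by case: z => a b; exact: sqrtr_ge0. Qed.

Lemma normc_Re z : `|complex.Re z| <= ComplexField.Normc.normc z.
Proof.
case: z => a b /=; rewrite -sqrtr_sqr ler_sqrt ?lerDl ?sqr_ge0//.
by rewrite addr_ge0 ?sqr_ge0.
Qed.

Lemma Re_sum (I : Type) (r : seq I) (P : pred I) (F : I -> R[i]) :
  complex.Re (\sum_(k <- r | P k) F k) = \sum_(k <- r | P k) complex.Re (F k).
Proof. by apply: big_morph => // -[a b] [a' b']. Qed.

Lemma spectral_unitaryl T : (spectralmx T)^t* *m spectralmx T = 1%:M.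
Proof.
rewrite -invmx_unitary ?spectral_unitarymx// mulVmx//.
exact: spectral_unit.
Qed.

Lemma spectral_unitaryr T : spectralmx T *m (spectralmx T)^t* = 1%:M.
Proof. exact/unitarymxP/spectral_unitarymx. Qed.

(** The [(i, j)] entry of the orthogonal projection onto the line spanned by column [k] of
    [(spectralmx T)^t*]. *)
Definition fc_weight T i j k : R[i] :=
  Num.conj (spectralmx T k i) * spectralmx T k j.

Lemma funcalcE f T i j :
  funcalc f T i j = \sum_k (f (eigval T k))%:C * fc_weight T i j k.
Proof.
rewrite /funcalc mul_mx_diag mxE; apply: eq_bigr => k _.
by rewrite !mxE mulrAC mulrC.
Qed.

Lemma fc_weight_le1 T i j k : ComplexField.Normc.normc (fc_weight T i j k) <= 1.
Proof.
(* The rows of a unitary matrix are unit vectors. *)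
have col (m : 'I_n) : `|spectralmx T k m| <= 1.
  have /matrixP/(_ k k) := spectral_unitaryr T.
  rewrite !mxE eqxx (bigD1 m)//= !mxE mulr1n => h.
  have : `|spectralmx T k m| ^+ 2 <= 1 ^+ 2.
    rewrite normCK expr1n -h lerDl sumr_ge0// => l _.
    by rewrite !mxE mul_conjC_ge0.
  by rewrite ler_pXn2r// nnegrE.
have : `|fc_weight T i j k| <= 1.
  by rewrite normrM norm_conjC mulr_ile1.
by rewrite normc_def -[1](rmorph1 (real_complex R)) lecR; case: (fc_weight _ _ _ _).
Qed.

Lemma Re_funcalc c f T i j : complex.Re (c * funcalc f T i j) =
  \sum_k f (eigval T k) * complex.Re (c * fc_weight T i j k).
Proof.
rewrite funcalcE mulr_sumr Re_sum; apply: eq_bigr => k _.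
by rewrite mulrCA Re_mulrC.
Qed.

(** Turns a uniform estimate on the eigenvalues into an entrywise one: there are [n] weights, each
    of modulus at most 1. *)
Lemma Re_funcalc_le c f T i j (e : R) : ComplexField.Normc.normc c <= 1 ->
  (forall k, `|f (eigval T k)| <= e) ->
  `|complex.Re (c * funcalc f T i j)| <= n%:R * e.
Proof.
move=> c1 fe; rewrite Re_funcalc.
apply: (le_trans (ler_norm_sum _ _ _)).
rewrite (_ : n%:R * e = \sum_(k < n) e); last first.
  by rewrite sumr_const card_ord mulr_natl.
rewrite ler_sum// => k _.
rewrite normrM -[leRHS]mulr1 ler_pM//.
apply: (le_trans (normc_Re _)); rewrite ComplexField.Normc.normcM.
by rewrite mulr_ile1 ?fc_weight_le1 ?normc_ge0.
Qed.

Lemma eq_funcalc f g T : (forall k, f (eigval T k) = g (eigval T k)) ->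
  funcalc f T = funcalc g T.
Proof.
move=> fg; apply/matrixP=> i j; rewrite [LHS]funcalcE [RHS]funcalcE.
by apply: eq_bigr => k _; rewrite fg.
Qed.

Lemma funcalcM f g T :
  funcalc f T *m funcalc g T = funcalc (fun x => f x * g x) T.
Proof.
have := spectral_unitaryr T; rewrite /funcalc.
set U := spectralmx T; set V := U^t*; set F := diag_mx _; set G := diag_mx _.
move=> UV.
have FG : F *m G = diag_mx (\row_j (f (eigval T j) * g (eigval T j))%:C).
  by rewrite mulmx_diag; congr diag_mx; apply/rowP => k; rewrite !mxE rmorphM.
by rewrite !mulmxA -(mulmxA _ U V) UV mulmx1 -(mulmxA _ F G) FG.
Qed.

Lemma funcalcD f g T : funcalc f T + funcalc g T = funcalc (fun x => f x + g x) T.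
Proof.
apply/matrixP => i j; rewrite mxE [RHS]funcalcE (funcalcE f) (funcalcE g).
rewrite -big_split; apply: eq_bigr => k _ /=.
by rewrite rmorphD mulrDl.
Qed.

Lemma funcalc_cst (r : R) T : funcalc (fun _ => r) T = (r%:C)%:M.
Proof.
rewrite /funcalc (_ : diag_mx _ = (r%:C)%:M); last first.
  by apply/matrixP => i j; rewrite !mxE.
by rewrite mul_mx_scalar -scalemxAl spectral_unitaryl scalemx1.
Qed.

Lemma funcalc_hermitian f T : (funcalc f T)^t* = funcalc f T.
Proof.
apply/matrixP => i j; rewrite [LHS]mxE [X in Num.conj X]mxE !funcalcE rmorph_sum.
apply: eq_bigr => k _; rewrite /fc_weight rmorphM; congr (_ * _).
  exact: conjc_real.
by rewrite rmorphM [LHS]mulrC; congr (_ * _); apply: conjcK.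
Qed.

Lemma funcalc_psd f T : (forall k, 0 <= f (eigval T k)) -> psd (funcalc f T).
Proof.
move=> f0; split; first exact: funcalc_hermitian.
move=> x; set y := spectralmx T *m x.
rewrite /funcalc !mulmxA (_ : x^t* *m _ = y^t*); last first.
  by rewrite /y trmx_mul map_mxM.
rewrite -mulmxA -/y mul_mx_diag mxE sumr_ge0// => k _.
rewrite !mxE mulrAC mulr_ge0//; last by rewrite ler0c; apply: f0.
by rewrite mulrC mul_conjC_ge0.
Qed.

Lemma det_funcalc f T : \det (funcalc f T) = (\prod_k f (eigval T k))%:C.
Proof.
rewrite /funcalc det_mulmx mulrC -det_mulmx mulmxA spectral_unitaryr mul1mx.
rewrite det_diag rmorph_prod; apply: eq_bigr => k _; by rewrite mxE.
Qed.

Lemma trace_funcalc f T : \tr (funcalc f T) = (\sum_k f (eigval T k))%:C.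
Proof.
rewrite /funcalc mxtrace_mulC mulmxA spectral_unitaryr mul1mx mxtrace_diag.
by rewrite rmorph_sum; apply: eq_bigr => k _; rewrite mxE.
Qed.

(** The spectral theorem; the eigenvalues of a Hermitian matrix are real, so nothing is lost by the
    real parts in [funcalc]. *)
Lemma psd_funcalc T : psd T -> T = funcalc id T.
Proof.
move=> [hT _].
have Th : T \is hermsymmx by apply/is_hermitianmxP; rewrite expr0 scale1r hT.
have dE : spectral_diag T = \row_j (id (eigval T j))%:C.
  apply/rowP => k; rewrite mxE /= RRe_real//.
  by have /mxOverP := hermitian_spectral_diag_real Th; exact.
rewrite /funcalc -dE -invmx_unitary ?spectral_unitarymx//.
exact/orthomx_spectralP/hermitian_normalmx.
Qed.

Lemma psd_eigval T : psd T -> forall k, 0 <= eigval T k.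
Proof.
move=> hT k; have [_ T0] := hT.
have := spectral_unitaryr T; have := psd_funcalc hT; rewrite /funcalc.
set U := spectralmx T; set V := U^t*; set D := diag_mx _ => eT UV.
(* Column [k] of [V] is a unit eigenvector, whose quadratic form is the [k]-th eigenvalue. *)
have := T0 (V *m delta_mx k 0); rewrite {1}eT.
have -> : (V *m delta_mx k 0)^t* = delta_mx (0 : 'I_1) k *m U.
  rewrite trmx_mul map_mxM trmxCK; congr (_ *m _).
  by apply/matrixP => i j; rewrite !mxE rmorph_nat andbC.
rewrite !mulmxA -(mulmxA _ U V) UV mulmx1 -(mulmxA _ U V) UV mulmx1.
by rewrite -colE -rowE !mxE eqxx mulr1n ler0c.
Qed.

End FunctionalCalculus.

(** * Complex and matrix-valued exponential sums *)

Section MatrixExponentialSums.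
Variable R : realType.
Implicit Types (F G : R -> R[i]) (c : R[i]) (p : R).

(* Both the real and the imaginary part of [F] are exponential sums. *)
Definition is_cexpsum F := forall c, is_expsum (fun p => complex.Re (c * F p)).

Lemma is_cexpsum_cst (z : R[i]) : is_cexpsum (fun _ => z).
Proof. by move=> c; apply: is_expsum_cst. Qed.

Lemma is_cexpsum_real (f : R -> R) :
  is_expsum f -> is_cexpsum (fun p => (f p)%:C).
Proof.
move=> hf c; apply: is_expsum_ext (is_expsumM (is_expsum_cst (complex.Re c)) hf).
by move=> p _ /=; rewrite mulrC Re_mulrC mulrC.
Qed.

Lemma is_cexpsumD F G :
  is_cexpsum F -> is_cexpsum G -> is_cexpsum (fun p => F p + G p).
Proof.
move=> hF hG c; apply: is_expsum_ext (is_expsumD (hF c) (hG c)) => p _ /=.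
by rewrite mulrDr; case: (c * F p) (c * G p) => [? ?] [? ?].
Qed.

Lemma is_cexpsumM F G :
  is_cexpsum F -> is_cexpsum G -> is_cexpsum (fun p => F p * G p).
Proof.
move=> hF hG c.
(* [Re (c F G) = Re F * Re (c G) - Im F * Im (c G)], with [Im F = Re (-i F)] and
   [- Im (c G) = Re (c i G)]. *)
apply: is_expsum_ext (is_expsumD (is_expsumM (hF 1) (hG c))
  (is_expsumM (hF (- 'i%C)) (hG (c * 'i%C)))) => p _ /=.
case: (F p) (G p) c => [a b] [a' b'] [u v] /=; ring.
Qed.

Lemma is_cexpsum_sum (I : Type) (r : seq I) (P : pred I) (F : I -> R -> R[i]) :
  (forall k, is_cexpsum (F k)) ->
  is_cexpsum (fun p => \sum_(k <- r | P k) F k p).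
Proof.
move=> hF; elim: r => [|k r IH].
  by move=> c; under eq_fun do rewrite big_nil; exact: is_cexpsum_cst.
move=> c; under eq_fun do rewrite big_cons.
by case: (P k); [exact: is_cexpsumD|exact: IH].
Qed.

Lemma is_cexpsum_prod (I : Type) (r : seq I) (P : pred I) (F : I -> R -> R[i]) :
  (forall k, is_cexpsum (F k)) ->
  is_cexpsum (fun p => \prod_(k <- r | P k) F k p).
Proof.
move=> hF; elim: r => [|k r IH].
  by move=> c; under eq_fun do rewrite big_nil; exact: is_cexpsum_cst.
move=> c; under eq_fun do rewrite big_cons.
by case: (P k); [exact: is_cexpsumM|exact: IH].
Qed.

Definition is_mexpsum m n (F : R -> 'M[R[i]]_(m, n)) :=
  forall i j, is_cexpsum (fun p => F p i j).

Lemma is_mexpsum_cst m n (A : 'M[R[i]]_(m, n)) : is_mexpsum (fun _ => A).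
Proof. by move=> i j; exact: is_cexpsum_cst. Qed.

Lemma is_mexpsumM m n q (F : R -> 'M[R[i]]_(m, n)) (G : R -> 'M[R[i]]_(n, q)) :
  is_mexpsum F -> is_mexpsum G -> is_mexpsum (fun p => F p *m G p).
Proof.
move=> hF hG i j c; under eq_fun do rewrite mxE.
by apply: is_cexpsum_sum => k; exact: is_cexpsumM.
Qed.

Lemma is_cexpsum_det n (F : R -> 'M[R[i]]_n) :
  is_mexpsum F -> is_cexpsum (fun p => \det (F p)).
Proof.
move=> hF; apply: is_cexpsum_sum => s; apply: is_cexpsumM.
  exact: is_cexpsum_cst.
by apply: is_cexpsum_prod => i; exact: hF.
Qed.

Lemma is_mexpsum_adj n (F : R -> 'M[R[i]]_n) :
  is_mexpsum F -> is_mexpsum (fun p => \adj (F p)).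
Proof.
move=> hF i j c; under eq_fun do rewrite mxE.
apply: is_cexpsumM; first exact: is_cexpsum_cst.
apply: is_cexpsum_det => k l c'; under eq_fun do rewrite !mxE.
exact: hF.
Qed.

(** The diagonalization of [T] is fixed; only the powers of its eigenvalues vary with the
    exponent. *)
Lemma is_mexpsum_psdpow n (T : 'M[R[i]]_n) : is_mexpsum (psdpow T).
Proof.
move=> i j c; under eq_fun do rewrite funcalcE.
apply: is_cexpsum_sum => k; apply: is_cexpsumM; last exact: is_cexpsum_cst.
exact: is_cexpsum_real (is_expsum_powR _).
Qed.

End MatrixExponentialSums.

(** * Comparison of the operator norm with the entries *)

Section OperatorNorm.
Variables (R : realType) (n : nat).
Local Notation normc := (@ComplexField.Normc.normc R).

Lemma normc_sum (I : Type) (r : seq I) (F : I -> R[i]) :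
  normc (\sum_(k <- r) F k) <= \sum_(k <- r) normc (F k).
Proof.
elim: r => [|k r IH]; first by rewrite !big_nil ComplexField.Normc.normc0.
rewrite !big_cons; apply: (le_trans (le_normcD _ _)).
by rewrite lerD2l.
Qed.

Lemma normc_le_ReIm (z : R[i]) :
  normc z <= `|complex.Re z| + `|complex.Im z|.
Proof.
case: z => a b /=; rewrite -[leRHS]ger0_norm ?addr_ge0// -sqrtr_sqr.
rewrite ler_sqrt ?sqr_ge0// sqrrD !real_normK ?num_real//.
by rewrite addrAC lerDl mulrn_wge0// mulr_ge0.
Qed.

Lemma l2norm_le_sum (x : 'cV[R[i]]_n) : l2norm x <= \sum_i normc (x i 0).
Proof.
have s0 : 0 <= \sum_i normc (x i 0) by apply: sumr_ge0 => i _; exact: normc_ge0.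
rewrite -[leRHS]ger0_norm// -sqrtr_sqr ler_sqrt ?sqr_ge0// expr2 mulr_suml.
apply: ler_sum => i _; rewrite expr2 ler_wpM2l ?normc_ge0//.
by rewrite (bigD1 i)//= lerDl sumr_ge0// => j _; exact: normc_ge0.
Qed.

Lemma normc_le_l2norm (x : 'cV[R[i]]_n) j : normc (x j 0) <= l2norm x.
Proof.
rewrite -[leLHS]ger0_norm ?normc_ge0// -sqrtr_sqr ler_sqrt.
  by rewrite (bigD1 j)//= lerDl sumr_ge0// => k _; exact: sqr_ge0.
by apply: sumr_ge0 => k _; exact: sqr_ge0.
Qed.

Lemma opnorm_bounds (T : 'M[R[i]]_n) :
  0 <= opnorm T <= \sum_i \sum_j normc (T i j).
Proof.
set S := \sum_i _; rewrite /opnorm; set E := image _ _.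
have ubE : ubound E S.
  move=> _ [x /= x1 <-]; apply: (le_trans (l2norm_le_sum _)).
  apply: ler_sum => i _; rewrite mxE; apply: (le_trans (normc_sum _ _)).
  apply: ler_sum => j _; rewrite ComplexField.Normc.normcM -[leRHS]mulr1.
  by rewrite ler_wpM2l ?normc_ge0// (le_trans (normc_le_l2norm x j)).
(* The zero vector makes the set nonempty, as both bounds on the supremum require. *)
have E0 : E (l2norm (T *m 0)).
  exists 0 => //=; apply: (le_trans (l2norm_le_sum _)).
  by rewrite big1 ?ler01// => i _; rewrite mxE ComplexField.Normc.normc0.
apply/andP; split; last by apply: ge_sup => //; exists (l2norm (T *m 0)).
apply: (@le_trans _ _ (l2norm (T *m 0))); first exact: sqrtr_ge0.
by apply: ub_le_sup => //; exists S.
Qed.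

End OperatorNorm.

(** * Positive semidefinite families of exponential sums and the limit of their roots *)

Lemma psd_congr (R : realType) (n : nat) (X T : 'M[R[i]]_n) :
  psd T -> psd (X^t* *m T *m X).
Proof.
move=> [hT T0]; split; first by rewrite !trmx_mul !map_mxM hT trmxCK !mulmxA.
by move=> x; have := T0 (X *m x); rewrite trmx_mul map_mxM !mulmxA.
Qed.

Section LimitOfPowers.
Variables (R : realType) (n : nat) (M : R -> 'M[R[i]]_n).
Hypotheses (Mexp : is_mexpsum M) (Mpsd : forall p, psd (M p)).

(** Each eigenvalue is at most the trace, which is an exponential sum. This provides the interval
    [[0, C]] for [sigmoid_approx]. *)
Lemma eigval_growth : exists C : R, 0 < C /\
  forall p, 1 <= p -> forall k, eigval (M p) k `^ p^-1 <= C.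
Proof.
have [s hs] : is_expsum (fun p => complex.Re (1 * \tr (M p))).
  by apply: is_cexpsum_sum => k; exact: Mexp.
have [C [C0 hC]] := expsum_growth s; exists C; split=> // p p1 k.
have ev0 := psd_eigval (Mpsd p); apply: hC => //.
rewrite -hs ?(lt_le_trans ltr01)// mul1r {2}(psd_funcalc (Mpsd p)).
rewrite trace_funcalc /= (bigD1 k)//= lerDl.
by apply: sumr_ge0 => j _; exact: ev0.
Qed.

Lemma sigmoid_funcalc_cvg (r : R) (c : R[i]) i j : 0 < r ->
  ComplexField.Normc.normc c <= 1 ->
  cvg (complex.Re (c * funcalc (sigmoid r p) (M p) i j) @[p --> +oo]).
Proof.
move=> r0 c1.
pose N p : 'M[R[i]]_n := M p + ((r `^ p)%:C)%:M.
have NE p : N p = funcalc (fun x => x + r `^ p) (M p).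
  by rewrite -funcalcD funcalc_cst -psd_funcalc.
have Nexp : is_mexpsum N.
  move=> k l c'; under eq_fun do rewrite mxE.
  apply: is_cexpsumD; first exact: Mexp.
  under eq_fun do rewrite mxE -mulr_natr.
  apply: is_cexpsumM; last exact: is_cexpsum_cst.
  exact: is_cexpsum_real (is_expsum_powR r).
have [t ht] : is_expsum (fun p => complex.Re (1 * \det (N p))).
  exact: is_cexpsum_det.
have [s hs] : is_expsum (fun p => complex.Re (c * (M p *m \adj (N p)) i j)).
  by apply: is_mexpsumM => //; exact: is_mexpsum_adj.
have pos p k : 0 < eigval (M p) k + r `^ p.
  by rewrite ltr_wpDl ?powR_gt0//; exact: psd_eigval.
(* Since the determinant is real, it can be moved through [Re], giving a real quotient. *)
have detN p : \det (N p) = (complex.Re (\det (N p)))%:C.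
  by rewrite NE det_funcalc.
apply: (@expsum_ratio_cvg _ s t _ n%:R).
- near=> p; rewrite -ht; last by near: p; exact: nbhs_pinfty_gt.
  rewrite mul1r NE det_funcalc /= gt_eqF//; apply: prodr_gt0 => k _; exact: pos.
- near=> p; rewrite -[n%:R]mulr1; apply: Re_funcalc_le => // k.
  have ev0 := psd_eigval (Mpsd p) k.
  by rewrite ger0_norm ?sigmoid_ge0 ?sigmoid_le1.
- near=> p; have p0 : 0 < p by near: p; exact: nbhs_pinfty_gt.
  rewrite -(ht p p0) -(hs p p0) mul1r mulrC -Re_mulrC -detN mulrCA.
  congr (complex.Re (_ * _)).
  (* Cramer's rule without an inverse: [M p] is the sigmoid matrix times [N p], and [N p] times its
     adjugate is the determinant. *)
  have -> : M p *m \adj (N p) = \det (N p) *: funcalc (sigmoid r p) (M p).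
    have {1}-> : M p = funcalc (sigmoid r p) (M p) *m N p.
      rewrite NE funcalcM {1}(psd_funcalc (Mpsd p)); apply: eq_funcalc => k.
      by rewrite divfK// gt_eqF.
    by rewrite -mulmxA mul_mx_adj mul_mx_scalar.
  by rewrite [RHS]mxE.
Unshelve. all: by end_near. Qed.

Lemma is_cvg_sumr (N : nat) (u : nat -> R -> R) :
  (forall k, cvg (u k p @[p --> +oo])) ->
  cvg ((\sum_(k < N) u k p) @[p --> +oo]).
Proof.
move=> hu; elim: N => [|N IH].
  by under eq_fun do rewrite big_ord0; exact: is_cvg_cst.
by under eq_fun do rewrite big_ord_recr /=; exact: is_cvgD.
Qed.

Lemma sumr_cvg0 (I : Type) (r : seq I) (u : I -> R -> R) :
  (forall k, u k p @[p --> +oo] --> (0 : R)) ->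
  (\sum_(k <- r) u k p) @[p --> +oo] --> (0 : R).
Proof.
move=> hu; elim: r => [|k r IH].
  by under eq_fun do rewrite big_nil; exact: cvg_cst.
under eq_fun do rewrite big_cons.
by have := cvgD (hu k) IH; rewrite addr0; apply.
Qed.

Lemma Re_psdpow_cvg (c : R[i]) i j : ComplexField.Normc.normc c <= 1 ->
  cvg (complex.Re (c * psdpow (M p) p^-1 i j) @[p --> +oo]).
Proof.
move=> c1; have [C [C0 hC]] := eigval_growth.
(* For each [e] it suffices to find a point whose [e]-ball eventually contains the values; the limit
   [l] of the Riemann sums for a mesh depending on [e] serves. *)
apply: cauchy_cvg; apply: cauchy_exP => e e0.
(* Half of [e], shared among the [n] eigenvalues; [n.+1] keeps the divisor nonzero when [n = 0]. *)
pose e' := e / (2 * n.+1%:R).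
have n0 : (0 : R) < n.+1%:R by rewrite ltr0n.
have e'0 : 0 < e' by rewrite divr_gt0// mulr_gt0.
have [N [d [d0 happ]]] := sigmoid_approx C0 e'0.
pose u k p := d * complex.Re (c * funcalc (sigmoid (k.+1%:R * d) p) (M p) i j).
have /cvg_ex [l ul] : cvg ((\sum_(k < N) u k p) @[p --> +oo]).
  apply: is_cvg_sumr => k; apply: is_cvgMr.
  by apply: sigmoid_funcalc_cvg => //; rewrite mulr_gt0.
exists l; rewrite /nbhs /=.
have e20 : 0 < e / 2 by rewrite divr_gt0.
have /cvgrPdist_lt/(_ _ e20) ule := ul.
near=> p; rewrite /ball /=.
have p1 : 1 <= p by near: p; exact: nbhs_pinfty_ge.
have p0 : 0 < p := lt_le_trans ltr01 p1.
have lu : `|l - \sum_(k < N) u k p| < e / 2 by near: p; exact: ule.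
have app : forall x, 0 <= x <= C ->
  `|x - \sum_(j < N) d * sigmoid (j.+1%:R * d) p (x `^ p)| <= e'.
  by near: p; exact: happ.
pose f x : R := x `^ p^-1 - \sum_(j < N) d * sigmoid (j.+1%:R * d) p x.
have fE : complex.Re (c * psdpow (M p) p^-1 i j) - \sum_(k < N) u k p =
    complex.Re (c * funcalc f (M p) i j).
  rewrite /psdpow [X in X - _]Re_funcalc [RHS]Re_funcalc.
  under [X in _ - X]eq_bigr do rewrite /u Re_funcalc mulr_sumr.
  rewrite exchange_big /= -sumrB; apply: eq_bigr => k _.
  rewrite /f mulrBl mulr_suml; congr (_ - _); apply: eq_bigr => m _.
  by rewrite mulrA.
have fle : `|complex.Re (c * funcalc f (M p) i j)| <= n%:R * e'.
  apply: Re_funcalc_le => // k; rewrite /f.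
  set x := eigval _ _; have x0 : 0 <= x by exact: psd_eigval.
  (* The approximation is applied at the root of the eigenvalue, which lies in [[0, C]]. *)
  have xE : x = (x `^ p^-1) `^ p by rewrite -powRrM mulVf ?gt_eqF// powRr1.
  under eq_bigr do rewrite {1}xE.
  by apply: app; rewrite powR_ge0 hC.
have ne : n%:R * e' <= e / 2.
  apply: (@le_trans _ _ (n.+1%:R * e')).
    by rewrite ler_wpM2r ?(ltW e'0)// ler_nat.
  suff -> : n.+1%:R * e' = e / 2 by [].
  by rewrite /e'; move: (n.+1%:R : R) (lt0r_neq0 n0) => m m0; field.
apply: le_lt_trans (ler_distD (\sum_(k < N) u k p) _ _) _.
rewrite [e]splitr; apply: ltr_leD => //.
by rewrite distrC fE; exact: le_trans fle ne.
Unshelve. all: by end_near. Qed.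

Lemma psdpow_cvg : exists L : 'M[R[i]]_n,
  opnorm (psdpow (M p) p^-1 - L) @[p --> +oo] --> (0 : R).
Proof.
pose h c i j p := complex.Re (c * psdpow (M p) p^-1 i j).
have N1 : ComplexField.Normc.normc (1 : R[i]) <= 1.
  by rewrite ComplexField.Normc.normc1.
have Ni : ComplexField.Normc.normc (- 'i%C : R[i]) <= 1.
  by rewrite /= oppr0 expr0n add0r sqrrN expr1n sqrtr1.
(* The imaginary part of [z] is obtained as [Re (-i z)]. *)
pose L : 'M[R[i]]_n := \matrix_(i, j)
  (lim (h 1 i j p @[p --> +oo]) +i* lim (h (- 'i%C) i j p @[p --> +oo])).
exists L.
pose D c i j p := `|h c i j p - lim (h c i j p @[p --> +oo])|.
have D0 c i j : ComplexField.Normc.normc c <= 1 ->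
    D c i j p @[p --> +oo] --> (0 : R).
  move=> c1; have hc : cvg (h c i j p @[p --> +oo]) by exact: Re_psdpow_cvg.
  rewrite -[X in _ --> X](@normr0 _ R) -(subrr (lim (h c i j p @[p --> +oo]))).
  by apply: cvg_norm; apply: cvgB; [exact: hc|exact: cvg_cst].
pose b p := \sum_i \sum_j (D 1 i j p + D (- 'i%C) i j p).
have b0 : b p @[p --> +oo] --> (0 : R).
  apply: sumr_cvg0 => i; apply: sumr_cvg0 => j.
  by rewrite -[X in _ --> X]addr0; apply: cvgD; apply: D0.
apply: (squeeze_cvgr _ (cvg_cst _) b0); near=> p.
have /andP[-> /le_trans] /= := opnorm_bounds (psdpow (M p) p^-1 - L); apply.
apply: ler_sum => i _; apply: ler_sum => j _.
rewrite mxE [X in _ + X]mxE [X in - X]mxE; apply: le_trans (normc_le_ReIm _) _.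
rewrite /D /h; case: (psdpow _ _ i j) => x y /=.
by rewrite !mul0r !mul1r !subr0 oppr0 !mul0r !sub0r mulN1r opprK.
Unshelve. all: by end_near. Qed.

End LimitOfPowers.

(** * Application to the family built from [A], [B] and [Z] *)

Theorem proposition6p1 (R : realType) (n : nat) (A B Z : 'M[R[i]]_n)
    (hA : psd A) (hB : psd B) :
  exists L : 'M[R[i]]_n,
    opnorm (psdpow (psdpow A p *m Z^t* *m psdpow B p *m Z *m psdpow A p) p^-1
            - L) @[p --> +oo] --> (0 : R).
Proof.
apply: psdpow_cvg => [|p].
  apply: is_mexpsumM (is_mexpsum_psdpow A).
  apply: is_mexpsumM (is_mexpsum_cst Z).
  apply: is_mexpsumM (is_mexpsum_psdpow B).
  exact: is_mexpsumM (is_mexpsum_psdpow A) (is_mexpsum_cst _).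
have hBp : psd (psdpow B p) by apply: funcalc_psd => k; exact: powR_ge0.
have hAp : (psdpow A p)^t* = psdpow A p by exact: funcalc_hermitian.
move: (psdpow B p) hBp (psdpow A p) hAp => Q hQ P hP.
(* As [P] is Hermitian, the product is the congruence of [Q] by [Z *m P]. *)
by have := psd_congr (Z *m P) hQ; rewrite trmx_mul map_mxM hP !mulmxA.
Qed.
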